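(* Let $E$ be a complex normed space, and take $n\in\mathbb N$. Then $$\|(x_1,\dots,x_n)\|_n^{\max}=\sup\Big\{\Big|\sum_{j=1}^n\langle x_j,\lambda_j\rangle\Big| : \lambda_1,\dots,\lambda_n\in E',\ \mu_{1,n}(\lambda_1,\dots,\lambda_n)\le1\Big\}$$ for each $x_1,\dots,x_n\in E$. Further, the dual norm on $(E')^n$ of $\|\cdot\|_n^{\max}$ is $\mu_{1,n}$.
   Context: A multi-norm based on a complex normed space $(E,\|\cdot\|)$ is a sequence $(\|\cdot\|_k:k\in\mathbb N)$, with $\|\cdot\|_k$ a norm on $E^k$ and $\|x\|_1=\|x\|$, such that for each $k\ge2$: (A1) $\|(x_{\sigma(1)},\dots,x_{\sigma(k)})\|_k=\|(x_1,\dots,x_k)\|_k$ for each permutation $\sigma$ of $\{1,\dots,k\}$; (A2) $\|(\alpha_1x_1,\dots,\alpha_kx_k)\|_k\le(\max_i|\alpha_i|)\|(x_1,\dots,x_k)\|_k$ for $\alpha_i\in\mathbb C$; (A3) $\|(x_1,\dots,x_{k-1},0)\|_k=\|(x_1,\dots,x_{k-1})\|_{k-1}$; (A4) $\|(x_1,\dots,x_{k-2},x_{k-1},x_{k-1})\|_k=\|(x_1,\dots,x_{k-1})\|_{k-1}$, for all $x_i\in E$. The maximum multi-norm $(\|\cdot\|_n^{\max}:n\in\mathbb N)$ based on $E$ is the multi-norm based on $E$ given by taking $\|(x_1,\dots,x_n)\|_n^{\max}$ to be the supremum of $\|(x_1,\dots,x_n)\|_n$ over all multi-norms $(\|\cdot\|_k:k\in\mathbb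 N)$ based on $E$. The dual of $E^n$ (with the norm $\|\cdot\|_n^{\max}$) is identified as a linear space with $(E')^n$ via $\langle(x_1,\dots,x_n),(\lambda_1,\dots,\lambda_n)\rangle=\sum_{j=1}^n\langle x_j,\lambda_j\rangle$. $\mu_{1,n}$ is the weak $1$-summing norm on $(E')^n$: $\mu_{1,n}(\lambda_1,\dots,\lambda_n)=\sup\{\sum_{j=1}^n|\langle\Lambda,\lambda_j\rangle| : \Lambda\in E'',\|\Lambda\|\le1\}$, which equals $\sup\{\sum_{j=1}^n|\langle x,\lambda_j\rangle|:x\in E,\|x\|\le1\}$. *)

(* Defs.v *)
From HB Require Import structures.
From mathcomp Require Import all_boot all_order all_algebra.
From mathcomp Require Import perm complex.
From mathcomp Require Import boolp classical_sets functions reals ereal.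
From mathcomp Require Import topology normedtype.

Set Implicit Arguments.
Unset Strict Implicit.
Unset Printing Implicit Defensive.

Import Order.TTheory GRing.Theory Num.Theory.
Import numFieldNormedType.Exports.
Local Open Scope classical_set_scope.
Local Open Scope complex_scope.
Local Open Scope ring_scope.

(* The library norm of a normed module over R[i] takes its values in R[i];
   this is the same norm read in R. *)
Definition rnorm (R : realType) (V : normedZmodType R[i]) (x : V) : R :=
  complex.Re `|x|.
Arguments rnorm {R V} x.

Section RNorm.
Context {R : realType} {V : normedZmodType R[i]}.
Implicit Types x y : V.

Lemma rnormE x : (rnorm x)%:C = `|x|.
Proof. by rewrite /rnorm RRe_real// normr_real. Qed.

Lemma rnorm_ge0 x : 0 <= rnorm x.
Proof. by rewrite -lecR rnormE normr_ge0. Qed.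

Lemma rnorm0 : rnorm (0 : V) = 0.
Proof. by rewrite /rnorm normr0. Qed.

Lemma rnorm0_eq0 x : rnorm x = 0 -> x = 0.
Proof. by move=> x0; apply/normr0_eq0; rewrite -rnormE x0. Qed.

Lemma ler_rnormD x y : rnorm (x + y) <= rnorm x + rnorm y.
Proof. by rewrite -lecR rmorphD/= !rnormE ler_normD. Qed.

End RNorm.

Lemma rnormZ (R : realType) (V : normedModType R[i]) (a : R[i]) (x : V) :
  rnorm (a *: x) = rnorm a * rnorm x.
Proof. by apply: complexI; rewrite rmorphM/= !rnormE normrZ. Qed.

Section Dual.
Context {R : realType}.
Implicit Type E : normedModType R[i].

Definition dual_pred E : {pred E -> R[i]^o} :=
  [pred f : E -> R[i]^o | `[< linear f /\ continuous f >]].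
Arguments dual_pred : clear implicits.

Record dual E := Dual {
  dual_fun :> E -> R[i]^o;
  dualP : dual_fun \in dual_pred E }.

HB.instance Definition _ E := [isSub for @dual_fun E].
HB.instance Definition _ E := [Choice of dual E by <:].

Fact dual_submod_closed E : submod_closed (dual_pred E).
Proof.
split=> [|a f g /asboolP[lf cf] /asboolP[lg cg]]; apply/asboolP; split.
- by move=> a x y; rewrite /= scaler0 addr0.
- by move=> x; exact: cvg_cst.
- move=> b x y; rewrite !fctE /= lf lg !scalerDr !scalerA.
  by rewrite (mulrC a b) addrACA.
- by move=> x; apply: cvgD; [apply: cvgZr; exact: cf|exact: cg].
Qed.

HB.instance Definition _ E :=
  GRing.isSubmodClosed.Build R[i] (E -> R[i]^o) (dual_pred E)
    (dual_submod_closed E).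

HB.instance Definition _ E := [SubChoice_isSubLmodule of dual E by <:].

Section DualElement.
Context {E : normedModType R[i]} (f : dual E).

Fact dual_linear : linear f.
Proof. by case/asboolP: (dualP f). Qed.

HB.instance Definition _ :=
  GRing.isLinear.Build R[i] E R[i]^o _ (dual_fun f) dual_linear.

Lemma dual_continuous : continuous f.
Proof. by case/asboolP: (dualP f). Qed.

Definition dual_norm : R :=
  sup [set rnorm (f x) | x in [set x : E | rnorm x <= 1]].

Lemma dual_has_sup :
  has_sup [set rnorm (f x) | x in [set x : E | rnorm x <= 1]].
Proof.
split; first by exists (rnorm (f 0)), 0 => //=; rewrite rnorm0 ler01.
have /linear_bounded_continuous/linear_boundedP := dual_continuous.
move=> /pinfty_ex_gt0[M M0 fM]; exists (complex.Re M) => _ [x /= x1 <-].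
have MR : (complex.Re M)%:C = M by rewrite RRe_real// gtr0_real.
rewrite -lecR MR rnormE (le_trans (fM x))// -[leRHS]mulr1.
apply: ler_wpM2l; first exact: ltW.
by rewrite -rnormE lecR.
Qed.

Lemma dual_norm_ub (x : E) : rnorm x <= 1 -> rnorm (f x) <= dual_norm.
Proof. by move=> x1; apply: sup_upper_bound; [exact: dual_has_sup|exists x]. Qed.

Lemma dual_norm_le (M : R) :
  (forall x : E, rnorm x <= 1 -> rnorm (f x) <= M) -> dual_norm <= M.
Proof.
move=> fM; apply: ge_sup; first by case: dual_has_sup.
by move=> _ [x x1 <-]; exact: fM.
Qed.

Lemma dual_norm_ge0 : 0 <= dual_norm.
Proof.
by rewrite (le_trans _ (@dual_norm_ub 0 _)) ?rnorm_ge0// rnorm0 ler01.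
Qed.

Lemma rnorm_dual_le (x : E) : rnorm (f x) <= dual_norm * rnorm x.
Proof.
have [->|x0] := eqVneq x 0; first by rewrite linear0 !rnorm0 mulr0.
have nx0 : 0 < rnorm x.
  by rewrite lt_neqAle rnorm_ge0 andbT eq_sym; apply: contra_neq x0 => /rnorm0_eq0.
have xV : rnorm ((rnorm x)^-1%:C) = (rnorm x)^-1.
  by rewrite /rnorm normc_def /= expr0n addr0 sqrtr_sqr ger0_norm ?invr_ge0 ?rnorm_ge0.
have := @dual_norm_ub ((rnorm x)^-1%:C *: x).
rewrite linearZ/= !rnormZ xV mulVf ?gt_eqF// => /(_ (lexx _)).
by rewrite mulrC ler_pdivrMr.
Qed.

End DualElement.

Lemma dual_normD E (f g : dual E) :
  (dual_norm (f + g))%:C <= (dual_norm f)%:C + (dual_norm g)%:C.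
Proof.
rewrite -rmorphD lecR; apply: dual_norm_le => x x1.
by rewrite (le_trans (ler_rnormD _ _))// lerD// dual_norm_ub.
Qed.

Lemma dual_normZ E (a : R[i]) (f : dual E) :
  (dual_norm (a *: f))%:C = `|a| * (dual_norm f)%:C.
Proof.
rewrite -rnormE -rmorphM; congr (_%:C).
have [->|a0] := eqVneq a 0.
  rewrite scale0r rnorm0 mul0r; apply/le_anti; rewrite dual_norm_ge0 andbT.
  by apply: dual_norm_le => x _; rewrite [_ x]/(0 : R[i]^o) rnorm0.
have na0 : 0 < rnorm a.
  by rewrite lt_neqAle rnorm_ge0 andbT eq_sym; apply: contra_neq a0 => /rnorm0_eq0.
apply/le_anti/andP; split.
  apply: dual_norm_le => x x1.
  by rewrite [_ x]/(a *: f x) rnormZ ler_wpM2l ?rnorm_ge0// dual_norm_ub.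
rewrite mulrC -ler_pdivlMr//; apply: dual_norm_le => x x1.
rewrite ler_pdivlMr// mulrC -rnormZ.
exact: (@dual_norm_ub _ (a *: f) x x1).
Qed.

Lemma dual_norm0_eq0 E (f : dual E) : (dual_norm f)%:C = 0 -> f = 0.
Proof.
move=> /complexI f0; apply/val_inj/funext => x /=.
apply: rnorm0_eq0; apply/le_anti; rewrite rnorm_ge0 andbT.
by rewrite (le_trans (rnorm_dual_le f x))// f0 mul0r.
Qed.

(* [dual E] is the normed space E'; hence [dual (dual E)] is E''. *)
HB.instance Definition _ E :=
  Lmodule_isNormed.Build R[i] (dual E)
    (@dual_normD E) (@dual_normZ E) (@dual_norm0_eq0 E).

Lemma rnorm_dualE E (f : dual E) : rnorm f = dual_norm f.
Proof. by []. Qed.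

End Dual.

Section MultiNorm.
Context {R : realType} (E : normedModType R[i]).

Definition is_norm (V : lmodType R[i]) (p : V -> R) : Prop :=
  [/\ forall x y, p (x + y) <= p x + p y,
      forall (a : R[i]) x, p (a *: x) = rnorm a * p x
    & forall x, p x = 0 -> x = 0].

(* (x_1, ..., x_k, y) *)
Definition snoc k (x : {ffun 'I_k -> E}) (y : E) : {ffun 'I_k.+1 -> E} :=
  [ffun i => oapp x y (unlift ord_max i)].

(* [N k] is a norm on E^k for k >= 1; the component [N 0] is left
   unconstrained and no other condition mentions it. *)
Record is_multi_norm (N : forall k, {ffun 'I_k -> E} -> R) : Prop := {
  mnorm_norm : forall k, (0 < k)%N -> is_norm (N k);
  mnorm1 : forall x : E, N 1 [ffun=> x] = rnorm x;
  mnormA1 : forall k (s : 'S_k) (x : {ffun 'I_k -> E}), (2 <= k)%N ->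
    N k [ffun i => x (s i)] = N k x;
  mnormA2 : forall k (a : 'I_k -> R[i]) (x : {ffun 'I_k -> E}), (2 <= k)%N ->
    N k [ffun i => a i *: x i] <= (\big[Num.max/0]_(i < k) rnorm (a i)) * N k x;
  mnormA3 : forall k (x : {ffun 'I_k -> E}), (0 < k)%N ->
    N k.+1 (snoc x 0) = N k x;
  mnormA4 : forall k (x : {ffun 'I_k.+1 -> E}),
    N k.+2 (snoc x (x ord_max)) = N k.+1 x }.

Local Open Scope ereal_scope.

Definition max_mnorm n (x : {ffun 'I_n -> E}) : \bar R :=
  ereal_sup [set (N n x)%:E | N in is_multi_norm].

Definition pairing n (x : {ffun 'I_n -> E}) (l : {ffun 'I_n -> dual E}) : R[i] :=
  (\sum_(j < n) l j (x j))%R.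

(* mu_{1,n}, as a supremum over the unit ball of E'' *)
Definition weak1_norm n (l : {ffun 'I_n -> dual E}) : \bar R :=
  ereal_sup [set (\sum_(j < n) rnorm (L (l j)))%:E
            | L in [set L : dual (dual E) | (rnorm L <= 1)%R]].

(* The norm of l, seen as the functional [pairing^~ l], in the dual of
   (E^n, max_mnorm) *)
Definition dual_max_mnorm n (l : {ffun 'I_n -> dual E}) : \bar R :=
  ereal_sup [set (rnorm (pairing x l))%:E
            | x in [set x : {ffun 'I_n -> E} | max_mnorm x <= 1]].

End MultiNorm.

(* Main.v *)
(* For the inequality <=, let N be a multi-norm and x a tuple. A Hahn-Banach
   functional norming x for the norm N_n on E^n is x |-> sum_j <x_j, l_j>.
   For ||y|| <= 1 choose scalars u_j of modulus at most 1 rotating each <y,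
   l_j> to its modulus; then sum_j |<y, l_j>| <= N_n(u_1 y, ..., u_n y) <=
   N_n(y, ..., y) = ||y|| by (A2) and (A4), so mu_{1,n}(l) <= 1. For >=, the
   right-hand side is itself a multi-norm. The same tuples (u_1 y, ..., u_n
   y) show that mu_{1,n} is the dual norm.

   The rotation trick also turns sum_j |L(l_j)| for L in E'' into |L(sum_j
   u_j l_j)|, which is why unit vectors of E suffice to compute mu_{1,n}.

   Hahn-Banach is obtained from Zorn's lemma applied to sublinear
   functionals defined on the whole space: a minimal one is linear. *)

Require Import Defs.
From HB Require Import structures.
From mathcomp Require Import all_boot all_order all_algebra.
From mathcomp Require Import perm complex.
From mathcomp Require Import boolp classical_sets functions reals ereal.
From mathcomp Require Import topology normedtype.
From mathcomp Require Import ring lra.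

Import Order.TTheory GRing.Theory Num.Theory.
Import numFieldNormedType.Exports.

Local Open Scope classical_set_scope.
Local Open Scope ereal_scope.

(** * Real-valued moduli of complex numbers, and rotations *)

Section ComplexNorm.
Set Implicit Arguments.
Unset Strict Implicit.
Local Open Scope complex_scope.
Local Open Scope ring_scope.
Context {R : realType}.

(** The rotation is [|z| / z]; [u = 0] serves at [z = 0], so the modulus is only bounded by 1, which
    is all that (A2) uses. *)
Lemma rnorm_rotation (z : R[i]) :
  exists2 u : R[i], rnorm u <= 1 & u * z = (rnorm z)%:C.
Proof.
have [->|z0] := eqVneq z 0.
  by exists 0; rewrite ?rnorm0 ?ler01// mul0r.
exists (`|z| / z); last by rewrite divfK// rnormE.
by rewrite -lecR rnormE normrM normr_id normfV divff ?normr_eq0.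
Qed.

Lemma rnorm_rotations n (z : 'I_n -> R[i]) : exists2 u : 'I_n -> R[i],
  forall j, rnorm (u j) <= 1 & \sum_j u j * z j = (\sum_j rnorm (z j))%:C.
Proof.
have /choice[u uP] j : exists u : R[i], rnorm u <= 1 /\ u * z j = (rnorm (z j))%:C.
  by have [u u1 uE] := rnorm_rotation (z j); exists u.
exists u => [j|]; first by case: (uP j).
by rewrite rmorph_sum; apply: eq_bigr => j _; case: (uP j).
Qed.

Lemma Re_le_rnorm (z : R[i]) : complex.Re z <= rnorm z.
Proof.
apply: le_trans (ler_norm _) _.
by rewrite -lecR rnormE normc_ge_Re.
Qed.

Lemma rnormC (t : R) : 0 <= t -> rnorm (t%:C : R[i]) = t.
Proof. by move=> t0; apply: complexI; rewrite rnormE ger0_norm// lecR. Qed.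

Lemma rnorm_gt0 (V : normedZmodType R[i]) (x : V) : x != 0 -> 0 < rnorm x.
Proof.
move=> x0; rewrite lt_neqAle rnorm_ge0 andbT eq_sym.
by apply: contra_neq x0 => /rnorm0_eq0.
Qed.

Lemma rnorm1 : rnorm (1 : R[i]) = 1.
Proof. by rewrite /rnorm normr1. Qed.

Lemma ler_rnorm_sum (V : normedZmodType R[i]) (I : Type) (r : seq I)
    (F : I -> V) :
  rnorm (\sum_(i <- r) F i) <= \sum_(i <- r) rnorm (F i).
Proof.
elim/big_rec2: _ => [|i y z _ yz]; first by rewrite rnorm0.
by rewrite (le_trans (ler_rnormD _ _))// lerD2l.
Qed.

Lemma rnormM (a b : R[i]) : rnorm (a * b) = rnorm a * rnorm b.
Proof. by apply: complexI; rewrite rmorphM/= !rnormE normrM. Qed.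

End ComplexNorm.

(** * Sublinear functionals and the Hahn-Banach theorem, real then complex *)

Section HahnBanach.
Set Implicit Arguments.
Unset Strict Implicit.
Local Open Scope complex_scope.
Local Open Scope ring_scope.
Context {R : realType} {V : lmodType R[i]}.
Implicit Types (p q : V -> R) (x y : V).

(** Homogeneity is asked only as an inequality for [t > 0], a form that infima inherit directly;
    [sublinearZ] recovers equality by using it at [t^-1]. *)
Definition sublinear p : Prop :=
  [/\ p 0 = 0, forall x y, p (x + y) <= p x + p y
    & forall (t : R) x, 0 < t -> p (t%:C *: x) <= t * p x].

Lemma sublinear_ge p x : sublinear p -> - p (- x) <= p x.
Proof. by case=> p0 pD _; have := pD x (- x); rewrite subrr p0; lra. Qed.

(** Serves both infima of the argument: over the shifts of one functional, and over a chain. [b]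
    keeps them finite. For shifts, [k] is a sum or a multiple of the parameters; for a chain, it is
    the smaller of two members, or the same member. *)
Lemma sublinear_inf (I : Type) (A : set I) (q : I -> V -> R) (b : V -> R) i0 :
    A i0 -> q i0 0 <= 0 -> b 0 = 0 ->
    (forall i x, A i -> b x <= q i x) ->
    (forall i j x y, A i -> A j ->
      exists2 k, A k & q k (x + y) <= q i x + q j y) ->
    (forall i (t : R) x, A i -> 0 < t ->
      exists2 k, A k & q k (t%:C *: x) <= t * q i x) ->
  sublinear (fun x => inf [set q i x | i in A]) /\
  (forall i x, A i -> inf [set q i x | i in A] <= q i x).
Proof.
move=> Ai0 qi0 b0 bq qD qZ.
have inf_lb i x : A i -> inf [set q i x | i in A] <= q i x.
  by move=> Ai; apply: ge_inf; [exists (b x) => _ [j Aj <-]; exact: bq|exists i].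
have inf_glb x r : (forall i, A i -> r <= q i x) ->
    r <= inf [set q i x | i in A].
  by move=> rq; apply: lb_le_inf; [exists (q i0 x), i0|move=> _ [i Ai <-]; exact: rq].
split=> //; split.
- apply/le_anti/andP; split; first exact: le_trans (inf_lb _ _ Ai0) qi0.
  by apply: inf_glb => i Ai; rewrite -b0; exact: bq.
- move=> x y; rewrite -lerBlDr; apply: (inf_glb x) => i Ai.
  rewrite lerBlDl -lerBlDr; apply: (inf_glb y) => j Aj; rewrite lerBlDl.
  by have [k Ak] := qD i j x y Ai Aj; apply: le_trans; exact: inf_lb.
- move=> t x t0; rewrite mulrC -ler_pdivrMr//; apply: inf_glb => i Ai.
  rewrite ler_pdivrMr// mulrC.
  by have [k Ak] := qZ i t x Ai t0; apply: le_trans; exact: inf_lb.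
Qed.

Lemma sublinearZ p (t : R) x : sublinear p -> 0 <= t ->
  p (t%:C *: x) = t * p x.
Proof.
case=> p0 pD pZ; rewrite le_eqVlt => /predU1P[<-|t0].
  by rewrite scale0r p0 mul0r.
apply/le_anti; rewrite pZ//= mulrC -ler_pdivlMr// mulrC.
have := pZ t^-1 (t%:C *: x); rewrite invr_gt0 => /(_ t0).
by rewrite scalerA -rmorphM/= mulVf ?gt_eqF// scale1r.
Qed.

(* Applied to a minimal p, it yields p (- x0) = - p x0. *)
Lemma sublinear_shift p x0 : sublinear p ->
  exists q, [/\ sublinear q, forall x, q x <= p x & q (- x0) <= - p x0].
Proof.
move=> sp; have [p0 pD pZ] := sp.
(* In the infimum over [t >= 0] of [p (y + t x0) - t p x0], the value [t = 0] gives [q <= p] and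
   [t = 1] gives the bound at [- x0]. *)
have [|||t y /= t0|s t x y /= s0 t0|s t x /= s0 t0|sq qp] := @sublinear_inf R
    [set t | 0 <= t] (fun t y => p (y + t%:C *: x0) - t * p x0)
    (fun y => - p (- y)) 0.
- exact: lexx.
- by rewrite scale0r addr0 p0 mul0r subr0.
- by rewrite oppr0 p0 oppr0.
- have := pD (- y) (y + t%:C *: x0); rewrite addKr.
  by rewrite (sublinearZ _ sp t0); lra.
- exists (s + t); first by rewrite /= addr_ge0.
  by rewrite rmorphD/= scalerDl addrACA; have := pD (x + s%:C *: x0) (y + t%:C *: x0); lra.
- exists (t * s); first by rewrite /= mulr_ge0// ltW.
  by rewrite rmorphM/= -scalerA -scalerDr; have := pZ t (x + s%:C *: x0) t0; lra.
exists (fun x => inf [set p (x + t%:C *: x0) - t * p x0 | t in [set t | 0 <= t]]).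
split=> // [x|]; last first.
  by have := qp 1 (- x0) ler01; rewrite scale1r addNr p0 mul1r sub0r.
by have := qp 0 x (lexx _); rewrite scale0r addr0 mul0r subr0.
Qed.

Lemma hahn_banach_real p x0 : sublinear p -> exists f : V -> R,
  [/\ forall x y, f (x + y) = f x + f y,
      forall (t : R) x, f (t%:C *: x) = t * f x,
      forall x, f x <= p x
    & f x0 = p x0].
Proof.
(* Zorn is run below [q] instead of [p]: a linear [f <= q] has [- f x0 = f (- x0) <= - p x0], which
   forces [f x0 = p x0]. *)
move=> sp; have [q [sq qp qx0]] := sublinear_shift x0 sp.
pose T := {r : V -> R | sublinear r /\ forall x, r x <= q x}.
(* The order is reversed, so that a maximal element is a minimal functional. *)
pose le_rel (r s : T) := `[< forall x, sval s x <= sval r x >].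
have [||||[f [sf fq]] fmin] := @ZL_preorder T (exist _ q _) le_rel.
- by split.
- by move=> r; apply/asboolP => x.
- move=> r s t /asboolP rs /asboolP st; apply/asboolP => x.
  exact: le_trans (st x) (rs x).
- move=> A Atot; have [[r0 Ar0]|A0] := pselect (exists r, A r); last first.
    by exists (exist _ q (conj sq (fun x => lexx _))) => s As; case: A0; exists s.
  have [||||r s x y Ar As|r t x Ar t0|sI Ile] := @sublinear_inf T A
      (fun r => sval r) (fun x => - q (- x)) r0.
  + by [].
  + by case: (svalP r0) => -[->].
  + by case: sq => q0 _ _; rewrite oppr0 q0 oppr0.
  (* Common lower bound along the chain: [- q (- x) <= - r (- x) <= r x]. *)
  + move=> r x _; have [sr rq] := svalP r.
    by apply: le_trans (sublinear_ge x sr); rewrite lerN2.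
  + have [/asboolP rs|/asboolP sr] := Atot r s Ar As.
    * exists s => //; have [[_ sD _] _] := svalP s.
      by apply: le_trans (sD _ _) _; rewrite lerD2r.
    * exists r => //; have [[_ rD _] _] := svalP r.
      by apply: le_trans (rD _ _) _; rewrite lerD2l.
  + by exists r => //; have [[_ _ rZ] _] := svalP r; exact: rZ.
  have Iq x : inf [set sval r x | r in A] <= q x.
    by apply: le_trans (Ile _ x Ar0) _; case: (svalP r0).
  by exists (exist _ (fun x => inf [set sval r x | r in A]) (conj sI Iq)) => s As;
    apply/asboolP => x; exact: Ile.
have fN x : f (- x) = - f x.
  have [g [sg gf gx]] := sublinear_shift x sf.
  have gq y : g y <= q y by apply: le_trans (gf y) (fq y).
  have /asboolP/= fg := fmin (exist _ g (conj sg gq)) (asboolT gf).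
  apply/le_anti; rewrite (le_trans (fg _) gx)/=.
  by rewrite lerNl; exact: sublinear_ge.
exists f; split.
- move=> x y; have [_ fD _] := sf; apply/le_anti; rewrite fD/=.
  (* Oddness turns subadditivity at [- x], [- y] into superadditivity at [x], [y]. *)
  by have := fD (- x) (- y); rewrite -opprD !fN; lra.
- move=> t x; have [t0|t0] := leP 0 t; first exact: sublinearZ.
  by rewrite -[t]opprK rmorphN scaleNr fN sublinearZ ?mulNr// oppr_ge0 ltW.
- by move=> x; exact: le_trans (fq x) (qp x).
- apply/le_anti; rewrite (le_trans (fq _) (qp _))/=.
  by have := fq (- x0); rewrite fN; move: qx0; lra.
Qed.

(** A real-linear [f] is the real part of the complex-linear [g x = f x - i f (i x)]; a rotation
    upgrades [f <= p] to [|g| <= p]. *)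
Lemma hahn_banach p x0 :
    (forall x y, p (x + y) <= p x + p y) ->
    (forall (a : R[i]) x, p (a *: x) = rnorm a * p x) ->
  exists f : {linear V -> R[i]^o},
    (forall x, rnorm (f x) <= p x) /\ rnorm (f x0) = p x0.
Proof.
move=> pD pZ.
have p0 : p 0 = 0 by rewrite -(scale0r 0) pZ rnorm0 mul0r.
have [|f [fD fZ fp fx0]] := @hahn_banach_real p x0.
  split=> //.
  by move=> t x t0; rewrite pZ rnormC// ltW.
have f0 : f 0 = 0 by have := fZ 0 0; rewrite scaler0 mul0r.
have fN x : f (- x) = - f x.
  by apply/eqP; rewrite -addr_eq0 -fD addNr f0.
pose g x : R[i]^o := f x -i* f (('i)%C *: x).
have fc (a : R[i]) x :
    f (a *: x) = complex.Re a * f x + complex.Im a * f (('i)%C *: x).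
  rewrite [in LHS](complexE a) scalerDl mulrC -scalerA fD !fZ//.
have fi x : f (('i)%C *: (('i)%C *: x)) = - f x.
  by rewrite scalerA -expr2 sqr_i scaleN1r fN.
have gl : linear g.
  move=> a x y.
  have e1 : f (a *: x + y) =
      complex.Re a * f x + complex.Im a * f (('i)%C *: x) + f y by rewrite fD fc.
  have e2 : f (('i)%C *: (a *: x + y)) =
      complex.Re a * f (('i)%C *: x) - complex.Im a * f x + f (('i)%C *: y).
    by rewrite scalerDr fD scalerA mulrC -scalerA fc fi mulrN.
  rewrite /g e1 e2 {e1 e2}.
  move: (f x) (f (_ *: x)) (f y) (f (_ *: y)) => s t s' t'; case: a => u v.
  rewrite [RHS]/((u +i* v) * (s -i* t) + (s' -i* t')).
  by simpc; congr (_ +i* _) => /=; ring.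
have gp x : rnorm (g x) <= p x.
  have [u u1 uE] := rnorm_rotation (g x).
  have -> : rnorm (g x) = f (u *: x).
    have g0 : g 0 = 0 by rewrite /g scaler0 f0 oppr0.
    have := gl u x 0; rewrite !addr0 g0 addr0 => /(congr1 (@complex.Re R)) /= ->.
    by rewrite [_ *: _]uE.
  rewrite (le_trans (fp _))// pZ ler_piMl//.
  (* What remains is [0 <= p x], from [0 = p (x - x) <= 2 p x]. *)
  have := pD x (- x); rewrite subrr p0.
  have -> : p (- x) = p x by rewrite -scaleN1r pZ /rnorm normrN1 mul1r.
  by lra.
pose G : {linear V -> R[i]^o} := HB.pack g (GRing.isLinear.Build _ _ _ _ g gl).
exists G; split=> //; apply/le_anti; rewrite gp/= -fx0.
exact: (Re_le_rnorm (g x0)).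
Qed.
End HahnBanach.

(** * The weak 1-summing norm, computed on [E] instead of [E''] *)

Section Weak1Norm.
Set Implicit Arguments.
Unset Strict Implicit.
Local Open Scope complex_scope.
Local Open Scope ring_scope.
Context {R : realType}.
Implicit Type E : normedModType R[i].

Lemma dual_of_bounded E (f : E -> R[i]^o) (M : R) : linear f ->
  (forall x, rnorm (f x) <= M * rnorm x) -> exists d : dual E, dual_fun d = f.
Proof.
move=> lf fM.
pose F : {linear E -> R[i]^o} := HB.pack f (GRing.isLinear.Build _ _ _ _ f lf).
suff fd : f \in @dual_pred R E by exists (Dual fd).
apply/asboolP; split=> //.
apply: (@bounded_linear_continuous _ _ _ F); apply/linear_boundedP.
(* Bounds live in [R[i]] here, so [M] is embedded and shown to be real. *)
exists M%:C; split=> [|r Mr x]; first by rewrite realE !lecE /= !eqxx le_total.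
have fMx : (rnorm (f x))%:C <= M%:C * (rnorm x)%:C by rewrite -rmorphM lecR.
rewrite -!rnormE; apply: (le_trans fMx).
by rewrite rnormE ler_wpM2r ?normr_ge0 ?ltW.
Qed.

Lemma dual_sumE E (I : Type) (r : seq I) (F : I -> dual E) (y : E) :
  (\sum_(i <- r) F i) y = \sum_(i <- r) F i y.
Proof. by elim/big_rec2: _ => [//|i u v _ <-]. Qed.

Lemma rnorm_normalize E (y : E) : y != 0 ->
  rnorm ((rnorm y)^-1%:C *: y) = 1.
Proof.
by move=> /rnorm_gt0 y0; rewrite rnormZ rnormC ?invr_ge0 ?rnorm_ge0// mulVf ?gt_eqF.
Qed.

(** Descends from [E''] to [E] without a density argument: after rotation the sum is [L] at the
    single functional [S], whose norm is tested on [E]. *)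
Lemma weak1_norm_le E n (l : {ffun 'I_n -> dual E}) (c : R) :
  (forall y, rnorm y <= 1 -> \sum_j rnorm (l j y) <= c) ->
  (weak1_norm l <= c%:E)%E.
Proof.
move=> lc; apply: ge_ereal_sup => _ [L /= L1 <-]; rewrite lee_fin.
have [u u1 uE] := rnorm_rotations (fun j => L (l j)).
pose S : dual E := \sum_j u j *: l j.
have LS : L S = (\sum_j rnorm (L (l j)))%:C.
  by rewrite linear_sum -uE; apply: eq_bigr => j _; rewrite linearZ.
rewrite -[leLHS]rnormC ?sumr_ge0// => [|j _]; last exact: rnorm_ge0.
rewrite -LS (le_trans (rnorm_dual_le L S))//.
apply: (@le_trans _ _ (rnorm S)); first by rewrite ler_piMl ?rnorm_ge0.
apply: dual_norm_le => y y1; rewrite dual_sumE.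
apply: le_trans (ler_rnorm_sum _ _) _; apply: le_trans (lc y y1).
apply: ler_sum => j _; rewrite [leLHS](rnormZ (u j) (l j y)).
by rewrite ler_piMl ?rnorm_ge0// u1.
Qed.

(** Evaluation at the normalized vector [z] lies in the unit ball of [E'']; scaling back covers
    every [y]. *)
Lemma weak1_norm_ge E n (l : {ffun 'I_n -> dual E}) (c : R) (y : E) :
  (weak1_norm l <= c%:E)%E -> \sum_j rnorm (l j y) <= c * rnorm y.
Proof.
move=> lc; have [->|y0] := eqVneq y 0.
  by rewrite rnorm0 mulr0 big1// => j _; rewrite linear0 rnorm0.
pose z := (rnorm y)^-1%:C *: y.
have nz : rnorm z = 1 by exact: rnorm_normalize.
have [||L LE] := @dual_of_bounded (dual E) (fun f => f z) 1.
- by [].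
- by move=> f; rewrite mul1r -[leRHS]mulr1 -nz; exact: rnorm_dual_le.
have L1 : rnorm L <= 1.
  apply: dual_norm_le => f f1; rewrite LE.
  by apply: le_trans f1; rewrite -[leRHS]mulr1 -nz; exact: rnorm_dual_le.
have : ((\sum_j rnorm (L (l j)))%:E <= c%:E)%E.
  by apply: le_trans lc; apply: ereal_sup_ubound; exists L.
have ny0 := rnorm_gt0 y0; rewrite lee_fin -ler_pdivrMr// => /(le_trans _); apply.
rewrite mulrC mulr_sumr; apply: ler_sum => j _.
by rewrite LE linearZ/= rnormZ rnormC// invr_ge0 rnorm_ge0.
Qed.

Lemma weak1_norm_le1P E n (l : {ffun 'I_n -> dual E}) :
  (weak1_norm l <= 1)%E <-> forall y, \sum_j rnorm (l j y) <= rnorm y.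
Proof.
split=> [l1 y|ly]; first by rewrite -[leRHS]mul1r; exact: weak1_norm_ge.
by apply: weak1_norm_le => y; apply: le_trans.
Qed.

(** Lets the weak norm be handled as a real constant: [L = 0] bounds it below, the sum of the dual
    norms above. *)
Lemma weak1_norm_fin E n (l : {ffun 'I_n -> dual E}) :
  exists2 c : R, 0 <= c & weak1_norm l = c%:E.
Proof.
have l0 : (0 <= weak1_norm l)%E.
  apply: (@le_trans _ _ (\sum_j rnorm ((0 : dual (dual E)) (l j)))%:E).
    by rewrite lee_fin sumr_ge0// => j _; exact: rnorm_ge0.
  by apply: ereal_sup_ubound; exists 0 => //=; rewrite rnorm0 ler01.
have : (weak1_norm l <= (\sum_j dual_norm (l j))%:E)%E.
  by apply: weak1_norm_le => y y1; apply: ler_sum => j _; exact: dual_norm_ub.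
case: (weak1_norm l) l0 => [c|//|//]; rewrite lee_fin => c0 _.
by exists c.
Qed.

End Weak1Norm.

(** * The right-hand side of the formula as a multi-norm *)

Section DualMultiNorm.
Set Implicit Arguments.
Unset Strict Implicit.
Local Open Scope complex_scope.
Local Open Scope ring_scope.
Context {R : realType} {E : normedModType R[i]}.

Lemma pairingDl n (x y : {ffun 'I_n -> E}) (l : {ffun 'I_n -> dual E}) :
  pairing (x + y) l = pairing x l + pairing y l.
Proof.
by rewrite /pairing -big_split; apply: eq_bigr => j _; rewrite ffunE linearD.
Qed.

Lemma pairingZl n (a : R[i]) (x : {ffun 'I_n -> E}) (l : {ffun 'I_n -> dual E}) :
  pairing (a *: x) l = a * pairing x l.
Proof.
by rewrite /pairing mulr_sumr; apply: eq_bigr => j _; rewrite ffunE linearZ.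
Qed.

Lemma pairingZC n (a : 'I_n -> R[i]) (x : {ffun 'I_n -> E})
    (l : {ffun 'I_n -> dual E}) :
  pairing [ffun j => a j *: x j] l = pairing x [ffun j => a j *: l j].
Proof. by apply: eq_bigr => j _; rewrite !ffunE linearZ. Qed.

(** Each [|l_j x_j|] is one term of the sum over [i] of [|l_i x_j|], which is at most the norm of
    [x_j]. *)
Lemma rnorm_pairing_le n (x : {ffun 'I_n -> E}) (l : {ffun 'I_n -> dual E}) :
  (weak1_norm l <= 1)%E -> rnorm (pairing x l) <= \sum_j rnorm (x j).
Proof.
move=> /weak1_norm_le1P l1; apply: le_trans (ler_rnorm_sum _ _) _.
apply: ler_sum => j _; apply: le_trans (l1 (x j)).
by rewrite (bigD1 j)//= lerDl sumr_ge0// => i _; exact: rnorm_ge0.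
Qed.

(** The right-hand side of the formula, as a real supremum because multi-norms take values in [R];
    [rnorm_pairing_le] makes it finite. *)
Definition predual_norm n (x : {ffun 'I_n -> E}) : R :=
  sup [set rnorm (pairing x l) | l in [set l | (weak1_norm l <= 1)%E]].

Lemma weak1_norm0 n : (weak1_norm ([ffun=> 0%R] : {ffun 'I_n -> dual E}) <= 1)%E.
Proof.
apply/weak1_norm_le1P => y; rewrite big1 ?rnorm_ge0// => j _.
by rewrite ffunE; exact: rnorm0.
Qed.

Lemma predual_norm_has_sup n (x : {ffun 'I_n -> E}) :
  has_sup [set rnorm (pairing x l) | l in [set l | (weak1_norm l <= 1)%E]].
Proof.
split.
  by eexists; exists [ffun=> 0 : dual E]; [exact: weak1_norm0|reflexivity].
by exists (\sum_j rnorm (x j)) => _ [l l1 <-]; exact: rnorm_pairing_le.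
Qed.

Lemma predual_norm_ub n (x : {ffun 'I_n -> E}) (l : {ffun 'I_n -> dual E}) :
  (weak1_norm l <= 1)%E -> rnorm (pairing x l) <= predual_norm x.
Proof.
by move=> l1; apply: sup_upper_bound; [exact: predual_norm_has_sup|exists l].
Qed.

Lemma predual_norm_le n (x : {ffun 'I_n -> E}) (M : R) :
  (forall l, (weak1_norm l <= 1)%E -> rnorm (pairing x l) <= M) ->
  predual_norm x <= M.
Proof.
move=> xM; apply: ge_sup; first by case: (predual_norm_has_sup x).
by move=> _ [l l1 <-]; exact: xM.
Qed.

Lemma predual_norm_ge0 n (x : {ffun 'I_n -> E}) : 0 <= predual_norm x.
Proof. by apply: le_trans (predual_norm_ub x (weak1_norm0 n)); exact: rnorm_ge0. Qed.

(** Scaling by [c^-1] moves [l] into the unit ball; at [c = 0] this is impossible, but then each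
    [l j] vanishes. *)
Lemma rnorm_pairing_le_predual n (x : {ffun 'I_n -> E})
    (l : {ffun 'I_n -> dual E}) (c : R) :
  0 <= c -> (weak1_norm l <= c%:E)%E ->
  rnorm (pairing x l) <= c * predual_norm x.
Proof.
rewrite le_eqVlt => /predU1P[<-|c0] lc.
  rewrite mul0r; apply: le_trans (ler_rnorm_sum _ _) _.
  apply: sumr_le0 => j _; have := weak1_norm_ge (x j) lc.
  rewrite mul0r; apply: le_trans.
  by rewrite (bigD1 j)//= lerDl sumr_ge0// => i _; exact: rnorm_ge0.
have cV : rnorm (c^-1%:C : R[i]) = c^-1 by rewrite rnormC// invr_ge0 ltW.
rewrite mulrC -ler_pdivrMr// mulrC -[in leLHS]cV -rnormM -pairingZl.
have -> : c^-1%:C *: x = [ffun j => c^-1%:C *: x j].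
  by apply/ffunP => j; rewrite !ffunE.
rewrite pairingZC; apply: predual_norm_ub; apply/weak1_norm_le1P => y.
rewrite (eq_bigr (fun j => c^-1 * rnorm (l j y))) => [|j _]; last first.
  by rewrite ffunE -[in RHS]cV; exact: (rnormZ _ (l j y)).
by rewrite -mulr_sumr mulrC ler_pdivrMr// mulrC; exact: weak1_norm_ge.
Qed.

(** The test tuple has a norming functional of [x j] in place [j] and 0 elsewhere. *)
Lemma rnorm_le_predual_norm n (x : {ffun 'I_n -> E}) j :
  rnorm (x j) <= predual_norm x.
Proof.
have [f [fle fx]] := hahn_banach (x j) (@ler_rnormD R E) (@rnormZ R E).
have [|d dE] := @dual_of_bounded R E f 1 (linearP f); first by move=> y; rewrite mul1r.
pose l : {ffun 'I_n -> dual E} := [ffun i => if i == j then d else 0].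
have -> : rnorm (x j) = rnorm (pairing x l).
  rewrite /pairing (bigD1 j)//= ffunE eqxx dE big1 ?addr0 ?fx// => i /negPf ij.
  by rewrite ffunE ij.
apply: predual_norm_ub; apply/weak1_norm_le1P => y.
rewrite (bigD1 j)//= ffunE eqxx dE big1 ?addr0// => i /negPf ij.
by rewrite ffunE ij; exact: rnorm0.
Qed.

Lemma predual_norm_is_norm n : is_norm (@predual_norm n).
Proof.
have Zle (a : R[i]) (x : {ffun 'I_n -> E}) :
    predual_norm (a *: x) <= rnorm a * predual_norm x.
  apply: predual_norm_le => l l1; rewrite pairingZl rnormM.
  by rewrite ler_wpM2l ?rnorm_ge0// predual_norm_ub.
split=> [x y|a x|x x0].
- apply: predual_norm_le => l l1; rewrite pairingDl.
  by apply: le_trans (ler_rnormD _ _) _; rewrite lerD// predual_norm_ub.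
- apply/le_anti; rewrite Zle/=; have [->|a0] := eqVneq a 0.
    by rewrite rnorm0 mul0r predual_norm_ge0.
  have na0 := rnorm_gt0 a0.
  have := Zle a^-1 (a *: x); rewrite scalerA mulVf// scale1r.
  rewrite -(ler_pM2l na0) mulrA -rnormM divff// rnorm1 mul1r; apply.
- apply/ffunP => j; rewrite ffunE; apply: rnorm0_eq0; apply/le_anti.
  by rewrite rnorm_ge0 andbT -x0 rnorm_le_predual_norm.
Qed.

(** [F] is arbitrary because [snoc] also extends tuples of functionals. *)
Lemma snoc_widen (F : normedModType R[i]) k (x : {ffun 'I_k -> F}) y i :
  snoc x y (widen_ord (leqnSn k) i) = x i.
Proof.
rewrite ffunE; have -> : widen_ord (leqnSn k) i = lift ord_max i.
  by apply: val_inj => /=; rewrite /bump leqNgt ltn_ord.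
by rewrite liftK.
Qed.

Lemma snoc_max (F : normedModType R[i]) k (x : {ffun 'I_k -> F}) y :
  snoc x y ord_max = y.
Proof. by rewrite ffunE unlift_none. Qed.

Lemma pairing_snoc k (x : {ffun 'I_k -> E}) y (l : {ffun 'I_k.+1 -> dual E}) :
  pairing (snoc x y) l =
  pairing x [ffun i => l (widen_ord (leqnSn k) i)] + l ord_max y.
Proof.
rewrite /pairing big_ord_recr/= snoc_max; congr (_ + _).
by apply: eq_bigr => j _; rewrite snoc_widen ffunE.
Qed.

(** Appending the zero functional keeps [l] admissible. This is the half common to (A3) and (A4). *)
Lemma predual_norm_snoc_ge k (x : {ffun 'I_k -> E}) y :
  predual_norm x <= predual_norm (snoc x y).
Proof.
apply: predual_norm_le => l /weak1_norm_le1P l1.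
have -> : pairing x l = pairing (snoc x y) (snoc l 0).
  rewrite pairing_snoc snoc_max [_ y]/(0 : R[i]^o) addr0.
  by apply: eq_bigr => j _; rewrite ffunE snoc_widen.
apply: predual_norm_ub; apply/weak1_norm_le1P => z.
rewrite big_ord_recr/= snoc_max [rnorm (_ 0 z)]rnorm0 addr0.
by under eq_bigr => j _ do rewrite snoc_widen.
Qed.

Lemma predual_norm_is_multi_norm : is_multi_norm (@predual_norm).
Proof.
split.
- by move=> k _; exact: predual_norm_is_norm.
- move=> x; apply/le_anti/andP; split.
    apply: predual_norm_le => l l1; apply: le_trans (rnorm_pairing_le _ l1) _.
    by rewrite big_ord1 ffunE.
  by apply: le_trans (rnorm_le_predual_norm _ ord0); rewrite ffunE.
- move=> k s x _.
  (* The permutation is moved onto the functionals; one inequality suffices, as it also applies to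
     the inverse. *)
  have perm_le (t : 'S_k) (z : {ffun 'I_k -> E}) :
      predual_norm [ffun i => z (t i)] <= predual_norm z.
    apply: predual_norm_le => l /weak1_norm_le1P l1.
    have -> : pairing [ffun i => z (t i)] l = pairing z [ffun i => l ((t^-1)%g i)].
      rewrite /pairing (reindex_perm t^-1)/=; apply: eq_bigr => j _.
      by rewrite !ffunE permKV.
    apply: predual_norm_ub; apply/weak1_norm_le1P => y.
    rewrite (reindex_perm t)/=.
    by under eq_bigr => j _ do rewrite ffunE permK.
  apply/le_anti; rewrite perm_le/=.
  have {1}-> : x = [ffun i => [ffun i => x (s i)] ((s^-1)%g i)].
    by apply/ffunP => i; rewrite !ffunE permKV.
  exact: perm_le.
(* Moved onto the functionals, the scalars multiply the weak norm by at most their largest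
   modulus. *)
- move=> k a x _; apply: predual_norm_le => l l1; rewrite pairingZC.
  have M0 : 0 <= \big[Num.max/0]_(i < k) rnorm (a i).
    exact: (@bigmax_ge_id _ R 'I_k (index_enum 'I_k) 0 xpredT (fun i => rnorm (a i))).
  apply: rnorm_pairing_le_predual => //.
  apply: weak1_norm_le => y y1.
  set M := (X in _ <= X) in M0 *.
  apply: (@le_trans _ _ (\sum_j M * rnorm (l j y))).
    apply: ler_sum => j _; rewrite ffunE [leLHS](rnormZ (a j) (l j y)).
    by rewrite ler_wpM2r ?rnorm_ge0//; exact: (@le_bigmax _ R).
  rewrite -mulr_sumr ler_piMr//; apply: le_trans y1.
  exact: ((weak1_norm_le1P l).1 l1 y).
- move=> k x _; apply/le_anti; rewrite predual_norm_snoc_ge andbT.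
  apply: predual_norm_le => l /weak1_norm_le1P l1.
  rewrite pairing_snoc linear0 addr0.
  apply: predual_norm_ub; apply/weak1_norm_le1P => y.
  apply: le_trans (l1 y); rewrite big_ord_recr/=.
  under eq_bigr => j _ do rewrite ffunE.
  by rewrite lerDl rnorm_ge0.
- move=> k x; apply/le_anti; rewrite predual_norm_snoc_ge andbT.
  apply: predual_norm_le => l /weak1_norm_le1P l1.
  (* The last two entries coincide, so the last two functionals are added into one; the triangle
     inequality keeps [m] admissible. *)
  pose m := [ffun i => l (widen_ord (leqnSn k.+1) i) +
    (if i == ord_max then l ord_max else 0)].
  have -> : pairing (snoc x (x ord_max)) l = pairing x m.
    rewrite pairing_snoc /pairing !big_ord_recr/= -addrA; congr (_ + _).
      apply: eq_bigr => j _; rewrite !ffunE ifF ?addr0//.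
      by apply/negbTE; rewrite -val_eqE /= ltn_eqF.
    by rewrite !ffunE eqxx.
  apply: predual_norm_ub; apply/weak1_norm_le1P => y.
  apply: le_trans (l1 y); rewrite !big_ord_recr/= -addrA; apply: lerD.
    rewrite le_eqVlt; apply/orP; left; apply/eqP.
    apply: eq_bigr => j _; rewrite !ffunE ifF ?addr0//.
    by apply/negbTE; rewrite -val_eqE /= ltn_eqF.
  by rewrite !ffunE eqxx; exact: ler_rnormD.
Qed.

End DualMultiNorm.

(** * Comparison with arbitrary multi-norms; the maximum multi-norm and its dual *)

Section MaximumMultiNorm.
Set Implicit Arguments.
Unset Strict Implicit.
Local Open Scope complex_scope.
Local Open Scope ring_scope.
Context {R : realType} {E : normedModType R[i]}.

Lemma sum_rnorm_pairing n (l : {ffun 'I_n -> dual E}) (y : E) :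
  exists2 u : 'I_n -> R[i], forall j, rnorm (u j) <= 1 &
    rnorm (pairing [ffun j => u j *: y] l) = \sum_j rnorm (l j y).
Proof.
have [u u1 uE] := rnorm_rotations (fun j => l j y).
exists u => //; rewrite -[RHS]rnormC ?sumr_ge0// => [|j _]; last exact: rnorm_ge0.
by rewrite -uE; congr rnorm; apply: eq_bigr => j _; rewrite ffunE linearZ.
Qed.

(** [l j] is [f] restricted to the [j]-th axis; the bound makes it continuous. *)
Lemma pairing_of_linear n (f : {linear {ffun 'I_n -> E} -> R[i]^o}) :
  (forall j y, rnorm (f [ffun i => (i == j)%:R *: y]) <= rnorm y) ->
  exists l : {ffun 'I_n -> dual E}, forall x, pairing x l = f x.
Proof.
move=> f1.
have /choice[d dE] j : exists d : dual E,
    forall y, d y = f [ffun i => (i == j)%:R *: y].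
  have [a y z|y|d dE] := @dual_of_bounded R E (fun y => f [ffun i => (i == j)%:R *: y]) 1.
  - rewrite -linearP; congr (f _); apply/ffunP => i.
    by rewrite !ffunE scalerDr !scalerA mulrC.
  - by rewrite mul1r.
  - by exists d => y; rewrite dE.
exists (finfun d) => x.
rewrite /pairing; under eq_bigr => j _ do rewrite ffunE dE.
rewrite -linear_sum; congr (f _); apply/ffunP => i.
rewrite sum_ffunE (bigD1 i)//= ffunE eqxx scale1r big1 ?addr0// => j ji.
by rewrite ffunE eq_sym (negPf ji) scale0r.
Qed.

Section MultiNorm.
Context (N : forall k, {ffun 'I_k -> E} -> R) (Nmulti : is_multi_norm N).
Arguments N : clear implicits.

(** (A4) removes one copy of [y] at a time, down to a single entry. *)
Lemma mnorm_const n (y : E) : N n.+1 [ffun=> y] = rnorm y.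
Proof.
elim: n => [|n IHn]; first exact: mnorm1.
rewrite -IHn -(mnormA4 (k := n) Nmulti [ffun=> y]); congr (N _ _); apply/ffunP => i.
by rewrite !ffunE; case: unliftP => [j|] _ /=; rewrite ?ffunE.
Qed.

(** (A2) starts at two entries, so a single entry is settled by homogeneity of the norm. *)
Lemma mnorm_scale_const n (a : 'I_n -> R[i]) (y : E) : (0 < n)%N ->
  (forall j, rnorm (a j) <= 1) -> N n [ffun j => a j *: y] <= rnorm y.
Proof.
case: n a => [//|[|n]] a _ a1.
  have -> : [ffun j => a j *: y] = a ord0 *: [ffun=> y].
    by apply/ffunP => j; rewrite !ffunE ord1.
  have [_ NZ _] := mnorm_norm Nmulti (ltn0Sn 0).
  by rewrite NZ mnorm_const ler_piMl ?rnorm_ge0.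
have -> : [ffun j => a j *: y] = [ffun j => a j *: [ffun=> y] j].
  by apply/ffunP => j; rewrite !ffunE.
apply: le_trans (mnormA2 Nmulti _ _ _) _ => //.
rewrite mnorm_const ler_piMl ?rnorm_ge0//.
exact: (@bigmax_le _ R _ _ _ 0).
Qed.

Lemma mnorm_le_predual_norm n (x : {ffun 'I_n -> E}) :
  (0 < n)%N -> N n x <= predual_norm x.
Proof.
move=> n0; have [ND NZ _] := mnorm_norm Nmulti n0.
have [f [fN fx]] := hahn_banach x ND NZ.
(* A vector on one axis is a constant tuple scaled by coefficients 0 and 1, so [mnorm_scale_const]
   also bounds [f] on the axes. *)
have [j y|l lE] := @pairing_of_linear n f.
  apply: le_trans (fN _) _; apply: (mnorm_scale_const _ n0) => i.
  by case: (i == j); rewrite ?rnorm1 ?rnorm0 ?ler01.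
rewrite -fx -lE; apply: predual_norm_ub; apply/weak1_norm_le1P => y.
have [u u1 <-] := sum_rnorm_pairing l y.
by rewrite lE; apply: le_trans (fN _) _; exact: mnorm_scale_const.
Qed.

End MultiNorm.

(** The supremum over all multi-norms is attained, at [predual_norm]. Positivity of [n] excludes the
    unconstrained component [N 0]. *)
Lemma max_mnormE n (x : {ffun 'I_n -> E}) : (0 < n)%N ->
  max_mnorm x = (predual_norm x)%:E.
Proof.
move=> n0; apply/le_anti/andP; split.
  by apply: ge_ereal_sup => _ [N NP <-]; rewrite lee_fin mnorm_le_predual_norm.
apply: ereal_sup_ubound; exists (@predual_norm R E) => //.
exact: predual_norm_is_multi_norm.
Qed.

Lemma dual_max_mnormE n (l : {ffun 'I_n -> dual E}) : (0 < n)%N ->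
  dual_max_mnorm l = weak1_norm l.
Proof.
move=> n0; apply/le_anti/andP; split.
  have [c c0 lc] := weak1_norm_fin l; rewrite lc.
  apply: ge_ereal_sup => _ [x /= x1 <-]; rewrite lee_fin.
  rewrite max_mnormE// lee_fin in x1.
  have := @rnorm_pairing_le_predual R E n x l c c0.
  rewrite lc => /(_ (lexx _))/le_trans; apply.
  by rewrite ler_piMr.
have ub y : rnorm y <= 1 -> ((\sum_j rnorm (l j y))%:E <= dual_max_mnorm l)%E.
  move=> y1; have [u u1 <-] := sum_rnorm_pairing l y.
  apply: ereal_sup_ubound; exists [ffun j => u j *: y] => //=.
  rewrite max_mnormE// lee_fin; apply: le_trans y1.
  exact: (mnorm_scale_const (@predual_norm_is_multi_norm R E)).
(* The value [-oo] is excluded by testing at [y = 0]. *)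
case: (dual_max_mnorm l) ub => [d|_|/(_ 0)]; first exact: weak1_norm_le.
  exact: leey.
by rewrite rnorm0 ler01 => /(_ isT).
Qed.

End MaximumMultiNorm.

Theorem theorem3p33 (R : realType) (E : normedModType R[i]) (n : nat)
    (n_gt0 : (0 < n)%N) :
  (forall x : {ffun 'I_n -> E},
     max_mnorm x =
     ereal_sup [set (rnorm (pairing x l))%:E
               | l in [set l : {ffun 'I_n -> dual E} | weak1_norm l <= 1]]) /\
  (forall l : {ffun 'I_n -> dual E}, dual_max_mnorm l = weak1_norm l).
Proof.
split=> [x|l]; last exact: dual_max_mnormE.
(* Real and extended suprema agree on a nonempty bounded set. *)
have [Anonempty Abounded] := predual_norm_has_sup x.
by rewrite max_mnormE// -ereal_sup_EFin// image_comp.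
Qed.
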